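(* Let $S$ be a translation surface. If $S$ has three algebraically periodic directions, then it has infinitely many. Moreover, if coordinates on $\mathbb{R}^2$ are chosen so that the directions with slopes $0$, $1$ and $\infty$ are algebraically periodic, then there is a field $K\subset\mathbb{R}$ such that the algebraically periodic directions of $S$ are exactly those with slopes in $K\cup\{\infty\}$, and $K$ is a number field with $[K:\mathbb{Q}]\le \mathrm{genus}(S)$.
   Context: A translation surface is a compact (connected, oriented) surface $S$ obtained by gluing finitely many polygons $P_1,\dots,P_n\subset\mathbb{R}^2$ along parallel edges by translations. View $\mathbb{R}^2$ and $\mathbb{R}$ as $\mathbb{Q}$-vector spaces. Take an edge-to-edge decomposition of $S$ into Euclidean triangles $\Delta_1,\dots,\Delta_m$ whose vertex set contains the singular points. Let $v_j,w_j\in\mathbb{R}^2$ be the coordinate vectors of two successive sides of $\Delta_j$ in counterclockwise order. The $J$-invariant is $J(S)=\sum_j v_j\wedge w_j\in\mathbb{R}^2\wedge_{\mathbb{Q}}\mathbb{R}^2$; it does not depend on the triangulation. For $0\ne v\in\mathbb{R}^2$ let $\pi:\mathbb{R}^2\to\mathbb{R}$ be the orthogonal projection with kernel $\mathbb{R}v$, and let $\mathrm{SAF}_v(S)\in\mathbb{R}\wedge_{\mathbb{Q}}\mathbb{R}$ be the image of $J(S)$ under the map $\mathbb{R}^2\wedge_{\mathbb{Q}}\mathbb{R}^2\to\mathbb{R}\wedge_{\mathbb{Q}}\mathbb{R}$ induced by $\pi$. The direction $v$ is algebraically periodic if $\mathrm{SAF}_v(S)=0$. Directions are identified with lines through the origin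 (slopes in $\mathbb{R}\cup\{\infty\}$). *)

(* Defs.v *)
From HB Require Import structures.
From mathcomp Require Import all_boot all_order all_algebra all_field.
From mathcomp Require Import generic_quotient ring_quotient.
From mathcomp Require Import boolp classical_sets cardinality reals.
From mathcomp Require Import finmap monalg.
From mathcomp Require Import ring.

Set Implicit Arguments.
Unset Strict Implicit.
Unset Printing Implicit Defensive.

Import Order.TTheory GRing.Theory Num.Theory.

Local Open Scope ring_scope.
Local Open Scope quotient_scope.

(** [V ∧_K V] is the quotient of the free [K]-module on [V * V] by the
    submodule spanned by the bilinearity and alternation relations. *)

Section ExteriorSquare.
Variables (K : fieldType) (V : lmodType K).

Local Notation free_on_pairs := {malg K[(V * V)%type]}.

Inductive wedge_rel : free_on_pairs -> Prop :=
| wedge_rel0 : wedge_rel 0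
| wedge_rel_comb a x y :
    wedge_rel x -> wedge_rel y -> wedge_rel (a *: x + y)
| wedge_rel_linl a u u' v :
    wedge_rel (<< (a *: u + u', v) >> - a *: << (u, v) >> - << (u', v) >>)
| wedge_rel_linr a u v v' :
    wedge_rel (<< (u, a *: v + v') >> - a *: << (u, v) >> - << (u, v') >>)
| wedge_rel_alt u : wedge_rel << (u, u) >>.

Definition wedge_rels : {pred free_on_pairs} := fun x => `[< wedge_rel x >].

Lemma wedge_relsP x : reflect (wedge_rel x) (x \in wedge_rels).
Proof. exact: asboolP. Qed.

Fact wedge_rels_closed : zmod_closed wedge_rels.
Proof.
split=> [|x y /wedge_relsP hx /wedge_relsP hy]; apply/wedge_relsP.
  exact: wedge_rel0.
by rewrite addrC -scaleN1r; apply: wedge_rel_comb.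
Qed.

HB.instance Definition _ :=
  GRing.isZmodClosed.Build free_on_pairs wedge_rels wedge_rels_closed.

Definition extsq := Quotient.quot (wedge_rels : zmodClosed free_on_pairs).

HB.instance Definition _ := GRing.Zmodule.on extsq.
HB.instance Definition _ : EqQuotient _ (Quotient.equiv wedge_rels) extsq :=
  EqQuotient.on extsq.

Definition wedge (u v : V) : extsq := \pi_extsq << (u, v) >>.

Lemma extsq_reprK (z : extsq) : \pi_extsq (repr z) = z.
Proof. exact: reprK. Qed.

Lemma extsq_pi_eq (x y : free_on_pairs) :
  \pi_extsq x = \pi_extsq y <-> wedge_rel (x - y).
Proof.
split=> [/eqP|h].
  rewrite eqmodE /= /Quotient.equiv => h; exact/wedge_relsP.
apply/eqP; rewrite eqmodE /= /Quotient.equiv; exact/wedge_relsP.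
Qed.

Lemma extsq_piD (x y : free_on_pairs) :
  \pi_extsq (x + y) = \pi_extsq x + \pi_extsq y.
Proof.
exact: (@pi_addr _ _ _ _ _ (Quotient.quot (wedge_rels : zmodClosed _))).
Qed.

Definition extsq_scale (a : K) (z : extsq) : extsq := \pi_extsq (a *: repr z).

Lemma extsq_piZ a (x : free_on_pairs) :
  \pi_extsq (a *: x) = extsq_scale a (\pi_extsq x).
Proof.
apply/extsq_pi_eq; rewrite -scalerBr -[_ *: _]addr0.
apply: wedge_rel_comb; last exact: wedge_rel0.
by apply/extsq_pi_eq; rewrite extsq_reprK.
Qed.

Fact extsq_scaleA a b z :
  extsq_scale a (extsq_scale b z) = extsq_scale (a * b) z.
Proof. by rewrite [extsq_scale b z]/extsq_scale -extsq_piZ scalerA. Qed.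

Fact extsq_scale1 : left_id 1 extsq_scale.
Proof. by move=> z; rewrite /extsq_scale scale1r extsq_reprK. Qed.

Fact extsq_scaleDr : right_distributive extsq_scale +%R.
Proof.
move=> a z t; rewrite -[z]extsq_reprK -[t]extsq_reprK.
move: (repr z) (repr t) => x y.
by rewrite -extsq_piD -!extsq_piZ scalerDr extsq_piD.
Qed.

Fact extsq_scaleDl z : {morph extsq_scale^~ z : a b / a + b}.
Proof. by move=> a b; rewrite /extsq_scale scalerDl extsq_piD. Qed.

HB.instance Definition _ := GRing.Zmodule_isLmodule.Build K extsq
  extsq_scaleA extsq_scale1 extsq_scaleDr extsq_scaleDl.

Lemma extsq_pi_linear : linear (\pi_extsq : free_on_pairs -> extsq).
Proof. by move=> a x y; rewrite extsq_piD extsq_piZ. Qed.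

HB.instance Definition _ := GRing.isLinear.Build K free_on_pairs extsq _
  \pi_extsq extsq_pi_linear.

Lemma wedge_linl v : linear (wedge^~ v).
Proof.
move=> a u u'; rewrite /wedge -linearP; apply/extsq_pi_eq.
by rewrite opprD addrA; apply: wedge_rel_linl.
Qed.

Lemma wedge_linr u : linear (wedge u).
Proof.
move=> a v v'; rewrite /wedge -linearP; apply/extsq_pi_eq.
by rewrite opprD addrA; apply: wedge_rel_linr.
Qed.

Lemma wedgevv u : wedge u u = 0.
Proof.
rewrite /wedge -(linear0 \pi_extsq); apply/extsq_pi_eq.
by rewrite subr0; apply: wedge_rel_alt.
Qed.

End ExteriorSquare.

Section InducedMap.
Variables (K : fieldType) (V W : lmodType K) (f : {linear V -> W}).

Definition pairs_map (x : {malg K[(V * V)%type]}) : extsq W :=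
  \sum_(k <- msupp x) x@_k *: wedge (f k.1) (f k.2).

Definition extsq_map (z : extsq V) : extsq W := pairs_map (repr z).

Lemma pairs_mapEw (D : {fset V * V}) x : (msupp x `<=` D)%fset ->
  pairs_map x = \sum_(k <- D) x@_k *: wedge (f k.1) (f k.2).
Proof.
move=> sxD; rewrite /pairs_map; apply: big_fset_incl => // k _ /mcoeff_outdom->.
by rewrite scale0r.
Qed.

Lemma pairs_map_linear : linear pairs_map.
Proof.
move=> a x y; pose D := (msupp x `|` msupp y `|` msupp (a *: x + y))%fset.
rewrite !(@pairs_mapEw D) /D ?fsubsetUr //.
- rewrite scaler_sumr -big_split /=; apply: eq_bigr => k _.
  by rewrite mcoeffD mcoeffZ scalerDl scalerA.
- by rewrite -fsetUA fsubsetU // fsubsetUl orbT.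
- by rewrite -fsetUA fsubsetUl.
Qed.

HB.instance Definition _ :=
  GRing.isLinear.Build K {malg K[(V * V)%type]} (extsq W) _
    pairs_map pairs_map_linear.

Lemma pairs_mapU u v : pairs_map << (u, v) >> = wedge (f u) (f v).
Proof.
by rewrite /pairs_map msuppU oner_eq0 big_seq_fset1 mcoeffUU scale1r.
Qed.

Lemma pairs_map_rel x : wedge_rel x -> pairs_map x = 0.
Proof.
elim=> [|a {}x y _ hx _ hy|a u u' v|a u v v'|u].
- exact: linear0.
- by rewrite linearP /= hx hy scaler0 addr0.
- rewrite !linearB linearZ /= !pairs_mapU linearP wedge_linl.
  by rewrite -addrA -opprD subrr.
- rewrite !linearB linearZ /= !pairs_mapU linearP wedge_linr.
  by rewrite -addrA -opprD subrr.
- by rewrite pairs_mapU wedgevv.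
Qed.

Lemma extsq_map_pi x : extsq_map (\pi_(extsq V) x) = pairs_map x.
Proof.
apply/eqP; rewrite -subr_eq0 /extsq_map -linearB /=; apply/eqP/pairs_map_rel.
by apply/extsq_pi_eq; rewrite extsq_reprK.
Qed.

Lemma extsq_map_linear : linear extsq_map.
Proof.
move=> a z t; rewrite -[z]extsq_reprK -[t]extsq_reprK.
move: (repr z) (repr t) => x y.
by rewrite -linearP !extsq_map_pi linearP.
Qed.

HB.instance Definition _ :=
  GRing.isLinear.Build K (extsq V) (extsq W) _ extsq_map extsq_map_linear.

Lemma extsq_map_wedge u v : extsq_map (wedge u v) = wedge (f u) (f v).
Proof. by rewrite extsq_map_pi pairs_mapU. Qed.

End InducedMap.

Definition rat_space (R : numFieldType) (V : lmodType R) : Type := V.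

Section RestrictScalars.
Variables (R : numFieldType) (V : lmodType R).

HB.instance Definition _ := GRing.Zmodule.on (rat_space V).

Definition rat_scale (a : rat) (v : rat_space V) : rat_space V :=
  (ratr a : R) *: (v : V).

Fact rat_scaleA a b v : rat_scale a (rat_scale b v) = rat_scale (a * b) v.
Proof. by rewrite /rat_scale scalerA rmorphM. Qed.

Fact rat_scale1 : left_id 1 rat_scale.
Proof. by move=> v; rewrite /rat_scale rmorph1 scale1r. Qed.

Fact rat_scaleDr : right_distributive rat_scale +%R.
Proof. by move=> a u v; rewrite /rat_scale scalerDr. Qed.

Fact rat_scaleDl v : {morph rat_scale^~ v : a b / a + b}.
Proof. by move=> a b; rewrite /rat_scale rmorphD scalerDl. Qed.

HB.instance Definition _ := GRing.Zmodule_isLmodule.Build rat (rat_space V)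
  rat_scaleA rat_scale1 rat_scaleDr rat_scaleDl.

End RestrictScalars.

Section Polygons.
Variable R : realType.

Definition plane := 'rV[R]_2.

Definition pt (x y : R) : plane := \row_j [:: x; y]`_j.

Definition xcoord (p : plane) : R := p 0 0.
Definition ycoord (p : plane) : R := p 0 1.

Definition cross (u v : plane) : R := xcoord u * ycoord v - ycoord u * xcoord v.

(** [polygon_simple] says that the boundary, parametrized by the half-open sides
    [[p_k, p_(k+1)[], is a simple closed curve; angles equal to [π] are allowed.
    By the shoelace formula [polygon_ccw] says that the signed area enclosed is
    positive, i.e. that the vertices are listed in counterclockwise order. *)
Record polygon := Polygon {
  nsides : nat;
  vertex : 'I_nsides -> plane;
  polygon_nsides : (2 < nsides)%N;
  polygon_simple : forall (k l : 'I_nsides) (s t : R),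
    0 <= s < 1 -> 0 <= t < 1 ->
    (1 - s) *: vertex k + s *: vertex (ordS k) =
    (1 - t) *: vertex l + t *: vertex (ordS l) ->
    k = l /\ s = t;
  polygon_ccw : 0 < \sum_k cross (vertex k) (vertex (ordS k))
}.

Definition sides (P : polygon) : seq (plane * plane) :=
  [seq (vertex k, vertex (ordS k)) | k <- enum 'I_(nsides P)].

Definition triangle : Type := plane * plane * plane.

Definition triangle_v (T : triangle) : plane := T.1.2 - T.1.1.
Definition triangle_w (T : triangle) : plane := T.2 - T.1.2.

Definition triangle_sides (T : triangle) : seq (plane * plane) :=
  let: (a, b, c) := T in [:: (a, b); (b, c); (c, a)].

Definition triangle_ccw (T : triangle) : bool :=
  0 < cross (triangle_v T) (triangle_w T).

(** Edge-to-edge decompositions of [P] into triangles such that the sides of [P]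
    are edges of the decomposition: the oriented triangle sides are the sides of
    [P] together with the interior edges [d], each taken once in either direction.
    As the triangles are positively oriented, the number of them that contain a
    generic point is the winding number of the boundary of [P] around it, so they
    cover [P] and do not overlap; and since both sides of an interior edge are
    filled by the two triangles bounded by it, no vertex lies inside an edge. *)
Definition triangulates (P : polygon) (t : seq triangle) : Prop :=
  all triangle_ccw t /\
  exists d : seq (plane * plane),
    perm_eq (flatten (map triangle_sides t))
            (sides P ++ d ++ [seq (e.2, e.1) | e <- d]).

End Polygons.

Section TranslationSurfaces.
Variable R : realType.

Definition side_of n (P : 'I_n -> polygon R) := {i : 'I_n & 'I_(nsides (P i))}.

Definition side_next n (P : 'I_n -> polygon R) (e : side_of P) : side_of P :=
  Tagged (fun i => 'I_(nsides (P i))) (ordS (tagged e)).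

Definition side_vec n (P : 'I_n -> polygon R) (e : side_of P) : plane R :=
  vertex (ordS (tagged e)) - vertex (tagged e).

(** Every side [e] is glued to the side [glue e] by a translation. The sides are
    oriented counterclockwise, so the two polygons lie on opposite sides of the
    common edge exactly when the two side vectors are opposite. *)
Record translation_surface := TranslationSurface {
  npolygons : nat;
  piece : 'I_npolygons -> polygon R;
  glue : side_of piece -> side_of piece;
  npolygons_gt0 : (0 < npolygons)%N;
  glueK : involutive glue;
  glue_translation : forall e, side_vec (glue e) = - side_vec e;
  surface_connected : forall i j : 'I_npolygons,
    connect [rel i j | [exists e, (tag e == i) && (tag (glue e) == j)]] i j
}.

Variable S : translation_surface.

(** The start of a side [e] is glued to the end of [glue e], that is, to the
    start of [side_next (glue e)]; iterating this turns around a vertex. *)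
Definition nvertices : nat :=
  fcard (fun e => side_next (@glue S e)) {: side_of (@piece S)}.

Definition nedges : nat := #|{: side_of (@piece S)}|./2.

(** [2 - 2g] is the Euler characteristic of the cell structure of [S]. *)
Definition genus : nat := ((2 + nedges) - (nvertices + npolygons S))./2.

Definition triangulation (t : 'I_(npolygons S) -> seq (triangle R)) : Prop :=
  forall i, triangulates (piece i) (t i).

Definition plane_wedge_plane := extsq (rat_space (plane R)).
Definition real_wedge_real := extsq (rat_space R^o).

Definition J_invariant (t : 'I_(npolygons S) -> seq (triangle R)) :
    plane_wedge_plane :=
  \sum_i \sum_(T <- t i)
    wedge (triangle_v T : rat_space (plane R)) (triangle_w T).

(** The orthogonal projection with kernel [R v], in the coordinate of the line
    orthogonal to [v] given by its unit vector [(- y, x) / |v|], [v = (x, y)]. *)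
Definition perp_proj (v : plane R) (w : rat_space (plane R)) : rat_space R^o :=
  cross v w / Num.sqrt (xcoord v ^+ 2 + ycoord v ^+ 2).

Fact perp_proj_linear v : linear (perp_proj v).
Proof.
move=> a u w; rewrite /perp_proj.
have -> : cross v (a *: u + w) = ratr a * cross v u + cross v w.
  by rewrite /cross /xcoord /ycoord !mxE; ring.
by rewrite mulrDl -mulrA.
Qed.

HB.instance Definition _ v := GRing.isLinear.Build rat
  (rat_space (plane R)) (rat_space R^o) _ (perp_proj v) (perp_proj_linear v).

Definition SAF (v : plane R) (J : plane_wedge_plane) : real_wedge_real :=
  extsq_map (perp_proj v) J.

(** [J_invariant t] is the same for all triangulations [t], so asking for one is
    asking for all. *)
Definition alg_periodic (v : plane R) : Prop :=
  v != 0 /\ exists t, triangulation t /\ SAF v (J_invariant t) = 0.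

End TranslationSurfaces.

(** Directions are slopes in [R ∪ {∞}], with [None] for [∞]. *)
Definition slope_vec (R : realType) (s : option R) : plane R :=
  if s is Some a then pt 1 a else pt 0 1.

(* Main.v *)
Require Import Defs.
From HB Require Import structures.
From mathcomp Require Import all_boot all_order all_algebra all_field.
From mathcomp Require Import boolp classical_sets cardinality reals.
From mathcomp Require Import finmap monalg ring zify.

(** Interior edges cancel in [J], so [J] is the sum of [p ∧ p'] over the sides
    [p, p'] of the polygons, whatever the triangulation. An element
    [\sum_i a_i ∧ b_i] of [R ∧_ℚ R] vanishes iff
    [\sum_i (f a_i * g b_i - f b_i * g a_i) = 0] for all ℚ-linear forms
    [f, g : R -> ℚ]. Write [x, y] for the coordinates of the vertices and
    [T (f, g) = \sum (f x * g y' - f x' * g y)]. When the slopes [0], [1] and [∞]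
    are algebraically periodic, [T] is symmetric, and a slope [s] is algebraically
    periodic iff [T (f (s _), g) = T (f, g (s _))] for all [f, g]. Such [s] form
    a field [K], which acts by multiplication on the nonzero ℚ-subspace of [R]
    spanned by the numbers [w g = \sum (x * g y' - x' * g y)].

    For the degree bound, [T] comes from the intersection form on
    [H^1(S; ℚ)], and the vanishing of [\sum x ∧ x'] says that the cocycles
    [f x] span an isotropic subspace of it, so this subspace has dimension at most
    the genus, while [f] is determined on the numbers [w g] by the class of
    [f x]. *)

Set Implicit Arguments.
Unset Strict Implicit.
Unset Printing Implicit Defensive.

Import Order.TTheory GRing.Theory Num.Theory.

Local Open Scope classical_set_scope.
Local Open Scope ring_scope.

(** * Linear forms and the exterior square *)

Section LinearForms.
Variables (K : fieldType) (V : lmodType K).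

(* A maximal subspace containing [P] and avoiding [v] has codimension one; [f] is
   the coordinate along [v]. *)
Lemma separating_form (P : set V) (v : V) :
    P 0 -> (forall a x y, P x -> P y -> P (a *: x + y)) -> ~ P v ->
  exists f : {linear V -> K^o}, (forall x, P x -> f x = 0) /\ f v = 1.
Proof.
move=> P0 Plin nPv.
pose good (M : set V) := (M 0 /\ P `<=` M) /\
  ((forall a x y, M x -> M y -> M (a *: x + y)) /\ ~ M v).
(* Adjoining [P] makes the condition hold for the empty chain too, whose union is empty. *)
have [|M [goodM maxM]] := @Zorn_bigcup V (fun M => good (M `|` P)).
  move=> F FP totF.
  have cupP : forall x, (\bigcup_(X in F) X `|` P) x ->
      P x \/ exists2 X, F X & (X `|` P) x.
    by move=> x [[X FX Xx]|Px]; [right; exists X => //; left|left].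
  split; first by split; [right|by move=> x; right].
  split=> [a x y Hx Hy|]; last first.
    by case=> [[X FX Xv]|//]; have [_ [_ []]] := FP _ FX; left.
  have step X : F X -> (X `|` P) x -> (X `|` P) y ->
      (\bigcup_(X in F) X `|` P) (a *: x + y).
    move=> FX Xx Xy; have [_ [linX _]] := FP _ FX.
    by have [?|?] := linX a _ _ Xx Xy; [left; exists X|right].
  have [Px|[X FX Xx]] := cupP _ Hx; have [Py|[Y FY Yy]] := cupP _ Hy.
  - by right; apply: Plin.
  - by apply: (step Y) => //; right.
  - by apply: (step X) => //; right.
  - have [XY|YX] := totF _ _ FX FY.
    + by apply: (step Y) => //; case: Xx => [/XY|]; [left|right].
    + by apply: (step X) => //; case: Yy => [/YX|]; [left|right].
have PM : P `<=` M.
  move=> x Px; apply: contrapT => nMx.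
  apply: (maxM (M `|` P)); last by rewrite -setUA setUid.
  by split=> [z Mz|MPM]; [left|apply: nMx; apply: MPM; right].
move: goodM; rewrite (setUidl PM) => -[[M0 _] [linM nMv]].
have MN x : M x -> M (- x) by move=> Mx; rewrite -scaleN1r -[_ *: _]addr0; apply: linM.
have MD x y : M x -> M y -> M (x + y) by move=> Mx My; rewrite -[x]scale1r; apply: linM.
have MZ a x : M x -> M (a *: x) by move=> Mx; rewrite -[_ *: _]addr0; apply: linM.
have decomp x : exists c, M (x - c *: v).
  apply: contrapT => nx.
  (* [M'] is the span of [M] and [x]. By maximality of [M] it contains [v], and solving
     [v - a *: x \in M] for [x] gives the coordinate [a^-1]. *)
  pose M' : set V := fun y => exists a, M (y - a *: x).
  have MM' : M `<=` M' by move=> y My; exists 0; rewrite scale0r subr0.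
  apply: (maxM M').
    split=> // M'M; apply: nx; exists 0; rewrite scale0r subr0; apply: M'M.
    by exists 1; rewrite scale1r subrr.
  rewrite (setUidl (subset_trans PM MM')).
  split; first by split; [exact: MM'|exact: subset_trans PM MM'].
  split.
    move=> a y z [b Mb] [c Mc]; exists (a * b + c).
    suff -> : a *: y + z - (a * b + c) *: x = a *: (y - b *: x) + (z - c *: x).
      exact: linM.
    by rewrite scalerDl opprD scalerBr scalerA addrACA.
  case=> a Ma; have [a0|a0] := eqVneq a 0.
    by apply: nMv; move: Ma; rewrite a0 scale0r subr0.
  apply: nx; exists a^-1.
  suff -> : x - a^-1 *: v = - (a^-1 *: (v - a *: x)) by apply/MN/MZ.
  by rewrite scalerBr scalerA mulVf // scale1r opprB.
have coord_uniq x b c : M (x - b *: v) -> M (x - c *: v) -> b = c.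
  move=> Mb Mc; apply: contrapT => /eqP nbc; apply: nMv.
  have /(MZ (b - c)^-1) : M ((b - c) *: v).
    suff -> : (b - c) *: v = (x - c *: v) - (x - b *: v) by apply/MD/MN.
    by rewrite opprB [RHS]addrC addrA subrK scalerBl.
  by rewrite scalerA mulVf ?scale1r // subr_eq0.
have [f fP] := choice decomp.
have flin : linear (f : V -> K^o).
  move=> a x y; apply: (coord_uniq (a *: x + y)) => //.
  suff -> : a *: x + y - (a * f x + f y) *: v =
      a *: (x - f x *: v) + (y - f y *: v) by apply: linM.
  by rewrite scalerDl opprD scalerBr scalerA addrACA.
exists (HB.pack_for {linear V -> K^o} (f : V -> K^o)
  (GRing.isLinear.Build K V K^o _ (f : V -> K^o) flin)).
split=> [x Px|] /=; apply: coord_uniq (fP _) _.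
  by rewrite scale0r subr0; apply: PM.
by rewrite scale1r subrr.
Qed.

(** Induction on the list: a vector that the current coordinates fail to reproduce is separated by a
    form [g] from the subspace that they do reproduce. *)
Lemma finite_coordinates (s : seq V) :
  exists n (e : 'I_n -> V) (f : 'I_n -> {linear V -> K^o}),
    {in s, forall v, v = \sum_i f i v *: e i}.
Proof.
elim: s => [|v s [n [e [f ef]]]].
  by exists 0, (fun=> 0), (fun=> \0).
pose P : set V := [set x | x = \sum_i f i x *: e i].
have [Pv|nPv] := pselect (P v).
  by exists n, e, f => u; rewrite inE => /predU1P[->|/ef].
have [||//|g [gP gv]] := @separating_form P v.
- by rewrite /P /= big1 // => i _; rewrite linear0 scale0r.
- move=> a x y Px Py; rewrite /P /= {1}Px {1}Py scaler_sumr -big_split.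
  by apply: eq_bigr => i _; rewrite linearP scalerDl scalerA.
(* The defect of the old expansion at [v]; with [g v = 1] it is restored at [v], and [g] vanishes on
   the earlier vectors. *)
pose v' := v - \sum_i f i v *: e i.
exists n.+1, (fun i => if unlift ord0 i is Some j then e j else v'),
  (fun i => if unlift ord0 i is Some j then f j else g) => u.
rewrite big_ord_recl unlift_none; under eq_bigr do rewrite liftK.
rewrite inE => /predU1P[->|su]; first by rewrite gv scale1r subrK.
by rewrite gP ?scale0r ?add0r; apply: ef.
Qed.

End LinearForms.

(** * Detecting zero in the exterior square by alternating forms *)

Section WedgeForms.
Variables (K : numFieldType) (V : lmodType K).

(** This is the functional [f ∧ g]: it extends linearly to the free module and kills the relations,
    so it descends to the quotient. *)
Lemma extsq_form (f g : {linear V -> K^o}) : exists F : {linear extsq V -> K^o},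
  forall u v, F (wedge u v) = f u * g v - f v * g u.
Proof.
pose b (k : V * V) : K := f k.1 * g k.2 - f k.2 * g k.1.
pose phi (x : {malg K[(V * V)%type]}) : K^o := \sum_(k <- msupp x) x@_k * b k.
have phiEw (D : {fset V * V}) x : (msupp x `<=` D)%fset ->
    phi x = \sum_(k <- D) x@_k * b k.
  move=> sxD; apply: big_fset_incl => // k _ /mcoeff_outdom->.
  by rewrite mul0r.
have phi_lin : linear phi.
  move=> a x y; pose D := (msupp x `|` msupp y `|` msupp (a *: x + y))%fset.
  rewrite !(@phiEw D) /D ?fsubsetUr //.
  - rewrite scaler_sumr -big_split /=; apply: eq_bigr => k _.
    by rewrite mcoeffD mcoeffZ mulrDl scalerA.
  - by rewrite -fsetUA fsubsetU // fsubsetUl orbT.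
  - by rewrite -fsetUA fsubsetUl.
pose Phi : {linear {malg K[(V * V)%type]} -> K^o} := HB.pack phi
  (GRing.isLinear.Build K {malg K[(V * V)%type]} K^o _ phi phi_lin).
have PhiU u v : Phi << (u, v) >> = b (u, v).
  by rewrite /= /phi msuppU oner_eq0 big_seq_fset1 mcoeffUU mul1r.
have Phi_rel x : wedge_rel x -> Phi x = 0.
  elim=> [|a {}x y _ hx _ hy|a u u' v|a u v v'|u].
  - exact: (linear0 Phi).
  - by rewrite linearP hx hy scaler0 addr0.
  - by rewrite !linearB linearZ !PhiU /b !linearP /= /GRing.scale /=; ring.
  - by rewrite !linearB linearZ !PhiU /b !linearP /= /GRing.scale /=; ring.
  - by rewrite PhiU /b subrr.
pose F (z : extsq V) : K^o := Phi (repr z).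
have Fpi x : F (\pi_(extsq V)%qT x) = Phi x.
  apply/eqP; rewrite -subr_eq0 /F -linearB; apply/eqP/Phi_rel.
  by apply/extsq_pi_eq; rewrite extsq_reprK.
have F_lin : linear F.
  move=> a z t; rewrite -[z]extsq_reprK -[t]extsq_reprK.
  by rewrite -linearP !Fpi linearP.
exists (HB.pack_for {linear extsq V -> K^o} F
  (GRing.isLinear.Build K (extsq V) K^o _ F F_lin)) => u v /=.
by rewrite Fpi PhiU.
Qed.

HB.instance Definition _ (u : V) :=
  GRing.isLinear.Build K V (extsq V) _ (wedge u) (wedge_linr u).

Lemma wedgeDl (u v w : V) : wedge (u + v) w = wedge u w + wedge v w.
Proof. by have := wedge_linl w 1 u v; rewrite !scale1r. Qed.

Lemma wedgeC (u v : V) : wedge u v = - wedge v u.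
Proof.
have := wedgevv (u + v); rewrite linearD /= !wedgeDl !wedgevv add0r addr0.
by move/eqP; rewrite addr_eq0 => /eqP->; rewrite opprK.
Qed.

(** Only finitely many vectors occur, so all of them expand in common coordinates [f k]; the
    antisymmetrized coefficient of [e k ∧ e l] is the value of [f k ∧ f l]. *)
Lemma sum_wedge_eq0 (I : finType) (a b : I -> V) :
  \sum_i wedge (a i) (b i) = 0 <->
  forall f g : {linear V -> K^o}, \sum_i (f (a i) * g (b i) - f (b i) * g (a i)) = 0.
Proof.
split=> [ab0 f g|ab0].
  have [F FE] := extsq_form f g.
  have := congr1 F ab0; rewrite linear_sum linear0 => F0.
  by under eq_bigr do rewrite -FE; exact: F0.
have [n [e [f ef]]] := finite_coordinates (codom a ++ codom b).
have ea i : a i = \sum_k f k (a i) *: e k by apply: ef; rewrite mem_cat codom_f.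
have eb i : b i = \sum_k f k (b i) *: e k.
  by apply: ef; rewrite mem_cat codom_f orbT.
have wE (u v : V) : u = \sum_k f k u *: e k -> v = \sum_k f k v *: e k ->
    wedge u v = \sum_k \sum_l (f k u * f l v) *: wedge (e k) (e l).
  move=> Eu Ev; rewrite [in LHS]Eu wedgeC linear_sum -sumrN.
  apply: eq_bigr => k _; rewrite /= linearZ /= -scalerN -wedgeC [in LHS]Ev linear_sum.
  by rewrite scaler_sumr; apply: eq_bigr => l _; rewrite linearZ /= scalerA.
(* Doubling the sum antisymmetrizes its coefficients, which then vanish by [ab0]. *)
have two0 : 2%:R != 0 :> K by rewrite pnatr_eq0.
apply: (scalerI two0); rewrite scaler0 scaler_nat mulr2n -big_split /=.
under eq_bigr => i _ do rewrite [X in _ + X]wedgeC (wE _ _ (ea i) (eb i))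
  (wE _ _ (eb i) (ea i)) -sumrB.
rewrite exchange_big big1 // => k _.
under eq_bigr do rewrite -sumrB; rewrite exchange_big big1 // => l _.
by under eq_bigr do rewrite -scalerBl; rewrite -scaler_suml ab0 scale0r.
Qed.

End WedgeForms.

(** * Isotropic families of potentials on a closed surface *)

Section FunctionsOnDarts.
Variables (F : numFieldType) (D : finType).
Implicit Types (p q : D -> D) (h k : D -> F).

Definition fun_row h : 'rV[F]_#|D| := \row_i h (enum_val i).

Definition pullback_mx p : 'M[F]_#|D| :=
  \matrix_(i, j) (enum_val i == p (enum_val j))%:R.

Lemma row_funE (u : 'rV[F]_#|D|) : u = fun_row (fun d => u 0 (enum_rank d)).
Proof. by apply/rowP => i; rewrite mxE enum_valK. Qed.

Lemma fun_rowK h d : fun_row h 0 (enum_rank d) = h d.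
Proof. by rewrite mxE enum_rankK. Qed.

Lemma eq_fun_row h k : fun_row h = fun_row k -> h =1 k.
Proof. by move=> hk d; rewrite -fun_rowK hk fun_rowK. Qed.

Lemma fun_rowB h k : fun_row (fun d => h d - k d) = fun_row h - fun_row k.
Proof. by apply/rowP => i; rewrite !mxE. Qed.

Lemma fun_rowD h k : fun_row (fun d => h d + k d) = fun_row h + fun_row k.
Proof. by apply/rowP => i; rewrite !mxE. Qed.

Lemma mul_pullback h p : fun_row h *m pullback_mx p = fun_row (h \o p).
Proof.
apply/rowP => j; rewrite !mxE (bigD1 (enum_rank (p (enum_val j)))) //= !mxE.
rewrite enum_rankK eqxx mulr1 big1 ?addr0 // => i ni; rewrite !mxE.
have /negPf-> : enum_val i != p (enum_val j); last by rewrite mulr0.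
by apply: contra ni => /eqP<-; rewrite enum_valK.
Qed.

Lemma row_matrix_fun m (A B : 'M[F]_(#|D|, m)) :
  (forall h, fun_row h *m A = fun_row h *m B) -> A = B.
Proof.
move=> AB; apply/row_matrixP => i.
by rewrite -[A]mul1mx -[B]mul1mx !row_mul [row i 1%:M]row_funE AB.
Qed.

Lemma pullback_mxM p q : pullback_mx p *m pullback_mx q = pullback_mx (p \o q).
Proof.
by apply: row_matrix_fun => h; rewrite mulmxA !mul_pullback.
Qed.

Lemma pullback_mx_id p : p =1 id -> pullback_mx p = 1%:M.
Proof.
by move=> pid; apply/matrixP => i j; rewrite !mxE pid (inj_eq enum_val_inj).
Qed.

Lemma tr_pullback_mx p q : cancel p q -> cancel q p ->
  (pullback_mx p)^T = pullback_mx q.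
Proof.
by move=> pK qK; apply/matrixP => i j; rewrite !mxE eq_sym (can2_eq pK qK).
Qed.

Lemma dot_fun_row h k :
  fun_row h *m (fun_row k)^T = (\sum_d h d * k d)%:M.
Proof.
apply/rowP => i; rewrite !ord1 !mxE eqxx (reindex _ (onW_bij _ (@enum_val_bij D))).
by apply: eq_bigr => j _; rewrite !mxE.
Qed.

(** Restricted to the columns in [P], the rows [u a] form an identity matrix. *)
Lemma leq_rank_indep (P : {pred D}) m (A : 'M[F]_(m, #|D|)) (u : D -> D -> F) :
    {in P &, forall a b, u a b = (a == b)%:R} ->
    {in P, forall a, (fun_row (u a) <= A)%MS} ->
  (#|P| <= \rank A)%N.
Proof.
move=> uE uA; pose B : 'M[F]_(#|P|, #|D|) := \matrix_(i, j) u (enum_val i) (enum_val j).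
have BA : (B <= A)%MS.
  apply/row_subP => i; have -> : row i B = fun_row (u (enum_val i)).
    by apply/rowP => j; rewrite !mxE.
  exact/uA/enum_valP.
suff /eqP <- : row_free B by apply: mxrankS.
apply/row_freeP; exists (\matrix_(j, i) (enum_val j == enum_val i)%:R).
apply/matrixP => i k; rewrite !mxE (bigD1 (enum_rank (enum_val k))) //= !mxE.
rewrite !enum_rankK eqxx mulr1 uE ?enum_valP // (inj_eq enum_val_inj).
rewrite big1 ?addr0 // => j nj; rewrite !mxE.
have /negPf-> : enum_val j != enum_val k; last by rewrite mulr0.
by apply: contra nj => /eqP<-; rewrite enum_valK.
Qed.

Lemma fixed_pullbackP p h :
  reflect (h \o p =1 h) (fun_row h <= kermx (pullback_mx p - 1%:M))%MS.
Proof.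
rewrite sub_kermx mulmxBr mulmx1 mul_pullback subr_eq0.
apply: (iffP eqP) => [/eq_fun_row //|ph].
by apply/rowP => i; rewrite !mxE ph.
Qed.

(** The indicator functions of the orbits are invariant and independent. *)
Lemma fcard_rank p : injective p ->
  (fcard p D <= \rank (kermx (pullback_mx p - 1%:M)))%N.
Proof.
move=> p_inj; rewrite /n_comp_mem.
apply: (@leq_rank_indep _ _ _ (fun a b => (a == froot p b)%:R)) => [a b|a].
  by rewrite !inE => _ /andP[/eqP -> _].
move=> _; apply/fixed_pullbackP => d /=; congr (_ == _)%:R.
by apply/esym/(fingraph.rootP (fconnect_sym p_inj)); exact: fconnect1.
Qed.

End FunctionsOnDarts.

Section IsotropicBound.
Variables (F : numFieldType) (D : finType) (phi alpha : D -> D).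
Hypotheses (phi_inj : injective phi) (alphaK : involutive alpha).
Hypothesis alpha_fixfree : forall d, alpha d != d.
Hypothesis connected : forall h : D -> F,
  h \o phi =1 h -> h \o alpha =1 h -> forall d d', h d = h d'.

(* Darts are the sides of polygons: [phi] is the next side, [alpha] the side glued
   to it. A 1-cocycle is given by its primitive [X] on the polygon corners, with
   value [X (phi d) - X d] on [d]; [period_pairing] is the cup product. *)
Definition closed_form (X : D -> F) := forall d,
  X (phi (alpha d)) - X (alpha d) = - (X (phi d) - X d).

Definition period_pairing (X Y : D -> F) := \sum_d (X d * Y (phi d) - X (phi d) * Y d).

Local Notation Phi := (pullback_mx F phi).
Local Notation Alpha := (pullback_mx F alpha).
Local Notation Sigma := (pullback_mx F (phi \o alpha)).
(** The row space of [Z] is the space of closed primitives, and [Omega] is the Gram matrix of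
    [period_pairing]. *)
Let Z := kermx ((Phi - 1%:M) *m (1%:M + Alpha)).
Let Omega := Phi^T - Phi.

Let phiK : cancel phi (finv phi). Proof. exact: finv_f. Qed.
Let finvK : cancel (finv phi) phi. Proof. exact: f_finv. Qed.

Let trPhiK : Phi^T *m Phi = 1%:M.
Proof.
by rewrite (tr_pullback_mx _ phiK finvK) pullback_mxM pullback_mx_id.
Qed.

Let trAlpha : Alpha^T = Alpha.
Proof. exact: tr_pullback_mx. Qed.

Let AlphaK : Alpha *m Alpha = 1%:M.
Proof. by rewrite pullback_mxM pullback_mx_id. Qed.

Let sigma_inj : injective (phi \o alpha).
Proof. exact: inj_comp phi_inj (inv_inj alphaK). Qed.

Lemma closed_formP X : reflect (closed_form X) (fun_row X <= Z)%MS.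
Proof.
rewrite sub_kermx mulmxA mulmxBr mulmx1 mul_pullback -fun_rowB mulmxDr mulmx1.
rewrite mul_pullback -fun_rowD.
apply: (iffP eqP) => [/rowP e d|XZ].
  have := e (enum_rank d); rewrite fun_rowK !mxE /= => /eqP.
  by rewrite addrC addr_eq0 => /eqP.
by apply/rowP => i; rewrite !mxE /= XZ subrr.
Qed.

Lemma period_pairingE X Y :
  fun_row X *m Omega *m (fun_row Y)^T = (period_pairing X Y)%:M.
Proof.
rewrite mulmxBr mulmxBl mul_pullback dot_fun_row -mulmxA -trmx_mul mul_pullback.
rewrite dot_fun_row -raddfB -sumrB; congr (_%:M).
Qed.

(** By connectedness, every row is a multiple of the constant row. *)
Lemma rank_invariant m (A : 'M[F]_(m, #|D|)) :
  (A <= kermx (Phi - 1%:M))%MS -> (A <= kermx (Alpha - 1%:M))%MS ->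
  (\rank A <= 1)%N.
Proof.
move=> AP AA; apply: leq_trans (rank_leq_row (fun_row (fun=> 1) : 'rV[F]_#|D|)).
apply/mxrankS/row_subP => i; set u := row i A.
have uP : (u <= kermx (Phi - 1%:M))%MS := submx_trans (row_sub i A) AP.
have uA : (u <= kermx (Alpha - 1%:M))%MS := submx_trans (row_sub i A) AA.
rewrite [u]row_funE in uP uA *.
move/fixed_pullbackP: uP => uP; move/fixed_pullbackP: uA => uA.
set h := fun d => _ in uP uA *.
have [d0 _|D0] := pickP (pred_of_simpl (@predT D)).
  suff -> : fun_row h = h d0 *: fun_row (fun=> 1) by apply: scalemx_sub.
  by apply/rowP => j; rewrite !mxE mulr1; apply: connected.
suff -> : fun_row h = 0 by apply: sub0mx.
by apply/rowP => j; have := D0 (enum_val j).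
Qed.

Lemma fcard_alpha : (fcard alpha D).*2 = #|D|.
Proof.
rewrite -muln2; apply: fcard_order_set => //; first exact: inv_inj.
apply/fintype.subsetP => d _; rewrite inE; apply/eqP.
apply: (@order_cycle _ _ [:: d; alpha d]); rewrite ?inE ?eqxx //=.
  by rewrite alphaK !eqxx.
by rewrite inE eq_sym alpha_fixfree.
Qed.

(* A relation between the closedness constraints is an [alpha]-invariant function
   that is also [phi]-invariant, hence constant; so all but one of the constraints,
   one for each [alpha]-orbit, are independent. *)
Lemma rank_closed_forms : (\rank Z + fcard alpha D <= #|D|.+1)%N.
Proof.
rewrite /Z mxrank_ker; set M := (_ *m _).
suff : (fcard alpha D <= (\rank M).+1)%N by have := rank_leq_row M; lia.
pose A := 1%:M + Alpha; pose B := (Phi - 1%:M)^T.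
have -> : \rank M = \rank (A *m B).
  by rewrite -mxrank_tr trmx_mul /A /B !linearD /= trAlpha trmx1.
have rkA : (fcard alpha D <= \rank A)%N.
  apply: leq_trans (fcard_rank F (inv_inj alphaK)) (mxrankS _).
  (* An [alpha]-invariant row satisfies [u *m A = 2 *: u], so half of it is a preimage. *)
  apply/rV_subP => u uA; rewrite -[u](scalerK (a := 2)) ?pnatr_eq0 //.
  apply/scalemx_sub/submxP; exists u; rewrite mulmxDr mulmx1.
  by move: uA; rewrite sub_kermx mulmxBr mulmx1 subr_eq0 => /eqP->; rewrite scaler_nat.
apply: leq_trans rkA _; rewrite -(mxrank_mul_ker A B) -addn1 leq_add2l.
apply: rank_invariant; rewrite sub_kermx mulmxBr mulmx1 subr_eq0.
  have : (A :&: kermx B <= kermx B)%MS by apply: capmxSr.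
  rewrite sub_kermx /B linearB /= trmx1 mulmxBr mulmx1 subr_eq0 => /eqP e.
  (* [Phi] is a permutation matrix, so what [Phi^T] fixes is fixed by [Phi]. *)
  by rewrite -[X in X *m Phi]e -mulmxA trPhiK mulmx1.
have /submxP[W ->] : (A :&: kermx B <= A)%MS by apply: capmxSl.
by rewrite /A -mulmxA mulmxDl mul1mx AlphaK addrC.
Qed.

(** Functions on the faces have zero increments: they represent the zero cocycle. *)
Lemma invariant_closed_form h : h \o phi =1 h -> closed_form h.
Proof. by move=> hphi d; rewrite -![h (phi _)]/((h \o phi) _) !hphi !subrr oppr0. Qed.

(** The orbits of [phi \o alpha] are the vertices, so the increments of [h] form a coboundary. *)
Lemma vertex_closed_form h : h \o (phi \o alpha) =1 h -> closed_form h.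
Proof.
move=> hs d; rewrite -[h (phi (alpha d))]/((h \o (phi \o alpha)) d) hs.
rewrite -[in h (phi d)](alphaK d) -[h (phi _)]/((h \o (phi \o alpha)) _) hs.
by rewrite opprB.
Qed.

(** Around each face [h] is constant and the increments of [X] sum to zero. *)
Lemma pairing_invariant h X : h \o phi =1 h -> period_pairing h X = 0.
Proof.
move=> hphi; have hE d : h (phi d) = h d := hphi d.
rewrite /period_pairing sumrB; under [X in _ - X]eq_bigr do rewrite hE.
rewrite [X in _ - X](reindex_inj phi_inj) /=.
by rewrite -sumrB big1 // => d _; rewrite hE subrr.
Qed.

(* Summation by parts: with [x d = X (phi d) - X d] the pairing is
   [\sum_d (h d + h (alpha d)) * x d], and [x] is odd under [alpha]. *)
Lemma pairing_vertex h X : h \o (phi \o alpha) =1 h -> closed_form X ->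
  period_pairing h X = 0.
Proof.
move=> hs XZ; pose x d := X (phi d) - X d.
have hE d : h (phi d) = h (alpha d) by rewrite -{1}(alphaK d); exact: hs.
have xE : \sum_d h (alpha d) * x d = - \sum_d h d * x d.
  rewrite (reindex_inj (inv_inj alphaK)) -sumrN.
  by apply: eq_bigr => d _; rewrite alphaK /x XZ mulrN.
have : period_pairing h X = \sum_d (h d * x d + h (alpha d) * x d +
    (h d * X d - h (phi d) * X (phi d))).
  by apply: eq_bigr => d _; rewrite -hE /x; ring.
move=> ->; rewrite !big_split /= xE subrr add0r sumrN.
by rewrite [X in X - _](reindex_inj phi_inj) subrr.
Qed.

(* The radical of the pairing contains the functions on faces and those on
   vertices, which share only the constants: a rank of at most
   [(E + 1) - (F + V - 1)] remains, and isotropic families have at most half of it. *)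
Theorem isotropic_bound n (c y : 'I_n -> D -> F) :
    (forall i, closed_form (c i)) -> (forall j, closed_form (y j)) ->
    (forall i j, period_pairing (c i) (c j) = 0) ->
    (forall i j, period_pairing (c i) (y j) = (i == j)%:R) ->
  (fcard phi D + fcard (phi \o alpha) D + n.*2 <= #|D|./2 + 2)%N.
Proof.
move=> cZ yZ cc cy.
pose C := \matrix_i fun_row (c i); pose Y := \matrix_i fun_row (y i).
have sub_mx (u : 'I_n -> D -> F) : (forall i, closed_form (u i)) ->
    (\matrix_i fun_row (u i) <= Z)%MS.
  by move=> uZ; apply/row_subP => i; rewrite rowK; apply/closed_formP.
have /submxP[C' CE] : (C <= Z)%MS by apply: sub_mx.
have /submxP[Y' YE] : (Y <= Z)%MS by apply: sub_mx.
have gram (u v : 'I_n -> D -> F) i j :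
    ((\matrix_i fun_row (u i)) *m Omega *m (\matrix_i fun_row (v i))^T) i j =
    period_pairing (u i) (v j).
  transitivity ((fun_row (u i) *m Omega *m (fun_row (v j))^T) 0 0).
    rewrite -[fun_row (u i)](rowK (fun i => fun_row (u i)) i).
    by rewrite -[fun_row (v j)](rowK (fun j => fun_row (v j)) j) tr_row -!row_mul
      [col j _]colE mulmxA -colE [RHS]mxE [RHS]mxE.
  by rewrite period_pairingE mxE eqxx.
have CC : C *m Omega *m C^T = 0 by apply/matrixP => i j; rewrite gram mxE cc.
have CY : C *m Omega *m Y^T = 1%:M by apply/matrixP => i j; rewrite gram mxE cy.
have OmegaT : Omega^T = - Omega by rewrite /Omega linearB /= trmxK opprB.
pose G := Z *m Omega *m Z^T.
have rkG : (n.*2 <= \rank G)%N.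
  have C'GY : C' *m G *m Y'^T = 1%:M by rewrite -CY CE YE trmx_mul !mulmxA.
  have Y'GC : (G *m C'^T)^T *m Y'^T = - 1%:M.
    have GT : G^T = - G.
      by rewrite /G trmx_mul trmxK trmx_mul OmegaT mulNmx mulmxN mulmxA.
    by rewrite trmx_mul trmxK GT mulmxN mulNmx C'GY.
  (* The rank of [G] is that of [G *m C'^T] plus that of the part of its row space killed by [C'^T].
     Both are at least [n]: the first by duality with [Y], the second because it contains the rows
     of [C' *m G], which are independent by the same duality and killed since [C] is isotropic. *)
  rewrite -(mxrank_mul_ker G C'^T) -addnn leq_add //.
    have := mxrankM_maxl (G *m C'^T)^T Y'^T.
    by rewrite Y'GC mxrank_opp mxrank1 mxrank_tr.
  have := mxrankM_maxl (C' *m G) Y'^T; rewrite C'GY mxrank1 => /leq_trans; apply.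
  apply: mxrankS; rewrite sub_capmx submxMl sub_kermx.
  by apply/eqP; rewrite -[RHS]CC CE trmx_mul /G !mulmxA.
pose Iphi := kermx (Phi - 1%:M); pose Isigma := kermx (Sigma - 1%:M).
have sub_rad h : closed_form h ->
    (forall X, closed_form X -> period_pairing h X = 0) ->
    (fun_row h <= Z :&: kermx (Omega *m Z^T))%MS.
  move=> hZ h0; rewrite sub_capmx; apply/andP; split; first exact/closed_formP.
  rewrite sub_kermx mulmxA -[_ *m Omega]trmxK -trmx_mul trmx_eq0.
  apply/eqP/row_matrixP => i; rewrite row0 row_mul.
  have: (row i Z <= Z)%MS by apply: row_sub.
  rewrite [row i Z]row_funE => /closed_formP/h0 e.
  by apply: trmx_inj; rewrite trmx_mul trmxK period_pairingE e trmx0 raddf0.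
have sub_phi : (Iphi <= Z :&: kermx (Omega *m Z^T))%MS.
  apply/rV_subP => u; rewrite [u]row_funE => /fixed_pullbackP uphi.
  by apply: sub_rad; [apply: invariant_closed_form
    | move=> X _; apply: pairing_invariant].
have sub_sigma : (Isigma <= Z :&: kermx (Omega *m Z^T))%MS.
  apply/rV_subP => u; rewrite [u]row_funE => /fixed_pullbackP us.
  by apply: sub_rad; [apply: vertex_closed_form | move=> X; apply: pairing_vertex].
have rkI : (\rank (Iphi :&: Isigma)%MS <= 1)%N.
  apply: rank_invariant; first exact: capmxSl.
  apply/rV_subP => u; rewrite sub_capmx [u]row_funE.
  case/andP=> /fixed_pullbackP uphi /fixed_pullbackP us; apply/fixed_pullbackP => d.
  (* Invariance under [phi] and [phi \o alpha] implies invariance under [alpha]. *)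
  by rewrite -[LHS]uphi; apply: us.
have rkR : (\rank (Iphi + Isigma)%MS <= \rank (Z :&: kermx (Omega *m Z^T))%MS)%N.
  by apply: mxrankS; rewrite addsmx_sub sub_phi.
have := mxrank_mul_ker Z (Omega *m Z^T); rewrite mulmxA -/G.
have := mxrank_sum_cap Iphi Isigma.
have := fcard_rank F phi_inj; have := fcard_rank F sigma_inj.
rewrite -/Iphi -/Isigma; have := rank_closed_forms; have := fcard_alpha.
have half : (#|D|./2 = fcard alpha D)%N by rewrite -fcard_alpha doubleK.
move: rkG rkR rkI; rewrite half; lia.
Qed.
End IsotropicBound.

(** * Subfields of finite degree over the rationals *)

Definition rat_free (R : unitRingType) n (b : 'I_n -> R) := forall c : 'I_n -> rat,
  \sum_i ratr (c i) * b i = 0 -> forall i, c i = 0.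

Section FiniteSubfield.
Variables (R : numFieldType) (S : {pred R}) (n : nat) (b : 'I_n -> R).
Hypothesis S_divring : divring_closed S.
Hypothesis b_free : rat_free b.
Hypothesis b_mem : forall i, b i \in S.
Hypothesis b_span : forall x, x \in S ->
  exists c : 'I_n -> rat, x = \sum_i ratr (c i) * b i.

HB.instance Definition _ := GRing.isDivringClosed.Build R S S_divring.

Definition subfield_type := {x | x \in S}.
HB.instance Definition _ :=
  [isSub of subfield_type for (@proj1_sig R (fun x => x \in S))].
HB.instance Definition _ := [Choice of subfield_type by <:].
HB.instance Definition _ := [SubChoice_isSubIntegralDomain of subfield_type by <:].
HB.instance Definition _ := [SubIntegralDomain_isSubField of subfield_type by <:].

Local Notation T := subfield_type.

Fact subfield_scale_mem (a : rat) (x : T) : ratr a * val x \in S.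
Proof. by rewrite rpredM ?(valP x) // /ratr rpred_div // rpred_int. Qed.

Definition subfield_scale (a : rat) (x : T) : T :=
  exist (fun x => x \in S) _ (subfield_scale_mem a x).

Fact val_subfield_scale a x : val (subfield_scale a x) = ratr a * val x.
Proof. by []. Qed.

Fact subfield_scaleA a c x :
  subfield_scale a (subfield_scale c x) = subfield_scale (a * c) x.
Proof. by apply: val_inj; rewrite /= rmorphM mulrA. Qed.

Fact subfield_scale1 : left_id 1 subfield_scale.
Proof. by move=> x; apply: val_inj; rewrite /= rmorph1 mul1r. Qed.

Fact subfield_scaleDr : right_distributive subfield_scale +%R.
Proof.
by move=> a x y; apply: val_inj; rewrite raddfD !val_subfield_scale raddfD mulrDr.
Qed.

Fact subfield_scaleDl x : {morph subfield_scale^~ x : a c / a + c}.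
Proof.
by move=> a c; apply: val_inj; rewrite raddfD !val_subfield_scale rmorphD mulrDl.
Qed.

HB.instance Definition _ := GRing.Zmodule_isLmodule.Build rat T
  subfield_scaleA subfield_scale1 subfield_scaleDr subfield_scaleDl.

Fact subfield_scaleAl (a : rat) (x y : T) : a *: (x * y) = a *: x * y.
Proof. by apply: val_inj; apply: mulrA. Qed.

HB.instance Definition _ := GRing.Lmodule_isLalgebra.Build rat T subfield_scaleAl.
HB.instance Definition _ := GRing.Lalgebra_isComAlgebra.Build rat T.

(** Coordinates in [b] exist by [b_span] and are unique by [b_free]; this fixes the dimension at
    [n]. *)
Fact subfield_vector : Vector.axiom n T.
Proof.
pose c (x : T) : 'rV[rat]_n := \row_i sval (cid (b_span (valP x))) i.
have cE x : val x = \sum_i ratr (c x 0 i) * b i.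
  rewrite {1}(svalP (cid (b_span (valP x)))).
  by apply: eq_bigr => i _; rewrite mxE.
have c_uniq x (u : 'rV[rat]_n) : val x = \sum_i ratr (u 0 i) * b i -> c x = u.
  move=> xu; apply/rowP => i; apply/eqP; rewrite -subr_eq0; apply/eqP.
  apply: (b_free (c := fun i => c x 0 i - u 0 i)).
  under eq_bigr do rewrite rmorphB mulrBl.
  by rewrite sumrB -cE xu subrr.
exists c.
  move=> a x y; apply: c_uniq; have -> : val (a *: x + y) = ratr a * val x + val y by [].
  rewrite !cE mulr_sumr.
  rewrite -big_split; apply: eq_bigr => i _.
  by rewrite !mxE rmorphD rmorphM mulrDl mulrA.
have mem u : \sum_i ratr ((u : 'rV[rat]_n) 0 i) * b i \in S.
  by apply: rpred_sum => i _; rewrite rpredM // /ratr rpred_div // rpred_int.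
exists (fun u => exist (fun x => x \in S) _ (mem u) : T) => [x|u].
  by apply: val_inj; rewrite [RHS]cE.
by apply: c_uniq.
Qed.

HB.instance Definition _ := Lmodule_hasFinDim.Build rat T subfield_vector.

Lemma finite_subfieldP : exists (K : fieldExtType rat) (iota : {rmorphism K -> R}),
  (forall x, x \in S <-> exists z, x = iota z) /\ \dim {:K} = n.
Proof.
exists (T : fieldExtType rat), (val : {rmorphism T -> R}); split; last exact: dimvf.
move=> x; split=> [Sx|[z ->]]; last exact: valP.
by exists (exist (fun x => x \in S) x Sx).
Qed.

End FiniteSubfield.

(** A free family in [S] of maximal length exists because lengths are bounded, and by maximality it
    spans [S]. *)
Lemma bounded_subfield (R : numFieldType) (S : {pred R}) (g : nat) :
    divring_closed S ->
    (forall n (b : 'I_n -> R), (forall i, b i \in S) -> rat_free b -> (n <= g)%N) ->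
  exists (K : fieldExtType rat) (iota : {rmorphism K -> R}),
    (forall x, x \in S <-> exists z, x = iota z) /\ (\dim {:K} <= g)%N.
Proof.
move=> S_divring bounded.
pose free_family n := exists2 b : 'I_n -> R, forall i, b i \in S & rat_free b.
pose P n := `[< free_family n >].
have P0 : exists n, P n.
  by exists 0; apply/asboolP; exists (fun=> 0) => [[]//|c _ []//].
have Pg n : P n -> (n <= g)%N by move=> /asboolP[b bS bfree]; apply: bounded bfree.
have [n /asboolP[b bS bfree] nmax] := ex_maxnP P0 Pg.
have span x : x \in S -> exists c : 'I_n -> rat, x = \sum_i ratr (c i) * b i.
  move=> Sx; apply: contrapT => nspan.
  have : P n.+1.
    apply/asboolP; exists (fun i => if unlift ord0 i is Some j then b j else x).
      by move=> i; case: unliftP.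
    move=> c; rewrite big_ord_recl unlift_none.
    under eq_bigr do rewrite liftK.
    move=> c0; have c00 : c ord0 = 0.
      apply/eqP; apply: contrapT => /negP cn0; apply: nspan.
      (* The relation solved for [x]. *)
      exists (fun i => - (c ord0)^-1 * c (lift ord0 i)).
      have cR : ratr (c ord0) != 0 :> R by rewrite fmorph_eq0.
      apply: (mulfI cR); move/eqP: c0; rewrite addr_eq0 => /eqP->.
      rewrite mulr_sumr -sumrN; apply: eq_bigr => i _.
      by rewrite rmorphM rmorphN fmorphV mulrA mulrA mulrN divff // mulN1r mulNr.
    move: c0; rewrite c00 rmorph0 mul0r add0r => /bfree cl i.
    by case: (unliftP ord0 i) => [j ->|->].
  by move/nmax; rewrite ltnn.
have [K [iota [iotaP dimK]]] := finite_subfieldP S_divring bfree bS span.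
by exists K, iota; split; rewrite ?dimK //; apply: Pg; apply/asboolP; exists b.
Qed.

(** * The field of periodic slopes *)

Local Notation rat_form R := {linear rat_space R^o -> rat^o}.

Section Dilation.
Variable R : numFieldType.

(** Multiplication by [s] as a ℚ-linear endomorphism, so that [f \o dilation s] is again a
    [rat_form]. *)
Definition dilation (s : R) (x : rat_space R^o) : rat_space R^o := s * (x : R).

Fact dilation_linear s : linear (dilation s).
Proof. by move=> a x y; rewrite /dilation mulrDr mulrCA. Qed.

HB.instance Definition _ s := GRing.isLinear.Build rat (rat_space R^o)
  (rat_space R^o) _ (dilation s) (dilation_linear s).

Lemma rat_form_mulr (f : rat_form R) (x : R) a : f (x * ratr a) = a * f x.
Proof. by rewrite mulrC; exact: (linearZ_LR f a x). Qed.

Lemma dual_forms n (b : 'I_n -> R) : rat_free b ->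
  exists f : 'I_n -> rat_form R, forall i j, f i (b j) = (i == j)%:R.
Proof.
move=> b_free; suff H i : exists f : rat_form R, forall j, f (b j) = (i == j)%:R.
  by have [f fP] := choice H; exists f.
(* The span of the [b j] with [j != i], from which [b i] is separated. *)
pose P : set R := [set x | exists2 c : 'I_n -> rat, c i = 0 &
  x = \sum_j ratr (c j) * b j].
have [|||f [fP fi]] := @separating_form rat (rat_space R^o) P (b i).
- by exists (fun=> 0) => //; rewrite big1 // => j _; rewrite rmorph0 mul0r.
- move=> a _ _ [c c0 ->] [d d0 ->].
  exists (fun j => a * c j + d j); first by rewrite c0 d0 mulr0 addr0.
  transitivity ((ratr a * \sum_j ratr (c j) * b j + \sum_j ratr (d j) * b j) : R) => //.
  rewrite mulr_sumr -big_split; apply: eq_bigr => j _.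
  by rewrite rmorphD rmorphM mulrDl mulrA.
- case=> c ci0 bE; have : \sum_j ratr (c j - (i == j)%:R) * b j = 0.
    under eq_bigr do rewrite rmorphB mulrBl; rewrite sumrB -bE.
    rewrite (bigD1 i) //= eqxx rmorph1 mul1r big1 ?addr0 ?subrr // => j /negPf nij.
    by rewrite eq_sym nij rmorph0 mul0r.
  by move/b_free/(_ i); rewrite ci0 eqxx sub0r => /eqP; rewrite oppr_eq0 oner_eq0.
exists f => j; have [<-//|nij] := eqVneq i j.
apply: fP; exists (fun k => (j == k)%:R); first by rewrite eq_sym (negPf nij).
rewrite (bigD1 j) //= eqxx rmorph1 mul1r big1 ?addr0 // => k /negPf njk.
by rewrite eq_sym njk rmorph0 mul0r.
Qed.

End Dilation.

Section PeriodicSlopes.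
Variables (R : numFieldType) (D : finType) (phi alpha : D -> D).

(** By [sum_wedge_eq0] this is the vanishing of the sum of [u d ∧ u (phi d)] in [R ∧_ℚ R]. *)
Definition isotropic (u : D -> R) := forall f g : rat_form R,
  period_pairing phi (f \o u) (g \o u) = 0.

Lemma isotropic_scale c (u : D -> R) : c != 0 ->
  isotropic u <-> isotropic (fun d => c * u d).
Proof.
move=> c0; split=> iso f g; first exact: (iso (f \o dilation c) (g \o dilation c)).
rewrite -[RHS](iso (f \o dilation c^-1) (g \o dilation c^-1)).
by apply: eq_bigr => d _; rewrite /= /dilation !mulKf.
Qed.

Variables X Y : D -> R.
Hypotheses (X_iso : isotropic X) (Y_iso : isotropic Y).
Hypothesis YX_iso : isotropic (fun d => Y d - X d).

Local Notation T f g := (period_pairing phi (f \o X) (g \o Y)).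

(** When the pairing is expanded bilinearly, isotropy of [X] and of [Y] leaves only the two mixed
    terms. *)
Lemma isotropic_slope s : isotropic (fun d => Y d - s * X d) <->
  forall f g : rat_form R, T (f \o dilation s) g = T (g \o dilation s) f.
Proof.
have E (f g : rat_form R) :
    period_pairing phi (f \o (fun d => Y d - s * X d)) (g \o (fun d => Y d - s * X d)) =
    T (g \o dilation s) f - T (f \o dilation s) g.
  rewrite -[RHS]addr0 -[in RHS](Y_iso f g).
  rewrite -[RHS]addr0 -[in RHS](X_iso (f \o dilation s) (g \o dilation s)).
  rewrite /period_pairing -sumrB -!big_split; apply: eq_bigr => d _ /=.
  by rewrite !raddfB /= /dilation; ring.
split=> iso f g; last by rewrite E iso subrr.
by apply/esym/eqP; rewrite -subr_eq0 -E iso.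
Qed.

(** The case [s = 1] of [isotropic_slope]. *)
Lemma period_formC (f g : rat_form R) : T f g = T g f.
Proof.
have /isotropic_slope sym : isotropic (fun d => Y d - 1 * X d).
  by under [fun d => _]eq_fun do rewrite mul1r.
by have := sym f g; congr (_ = _); apply: eq_bigr => d _; rewrite /= /dilation !mul1r.
Qed.

Definition slope_pred : {pred R} := fun s => `[< isotropic (fun d => Y d - s * X d) >].

(** As [T] is symmetric, slopes are the numbers whose dilation is self-adjoint for [T]. *)
Lemma slope_predP s : reflect
  (forall f g : rat_form R, T (f \o dilation s) g = T f (g \o dilation s))
  (s \in slope_pred).
Proof.
rewrite unfold_in; apply: (iffP (asboolP _)) => [/isotropic_slope h f g|h].
  by rewrite h period_formC.
by apply/isotropic_slope => f g; rewrite h period_formC.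
Qed.

(** Dilations commute, so differences and quotients of self-adjoint ones are self-adjoint. *)
Lemma slope_pred_divring : divring_closed slope_pred.
Proof.
have S1 : 1 \in slope_pred.
  by apply/slope_predP => f g; apply: eq_bigr => d _; rewrite /= /dilation !mul1r.
split=> // s t /slope_predP sP /slope_predP tP; apply/slope_predP => f g.
  transitivity (T (f \o dilation s) g - T (f \o dilation t) g).
    rewrite /period_pairing -sumrB; apply: eq_bigr => d _ /=.
    by rewrite /dilation !mulrBl !raddfB /=; ring.
  rewrite sP tP /period_pairing -sumrB; apply: eq_bigr => d _ /=.
  by rewrite /dilation !mulrBl !raddfB /=; ring.
(* Here [s / 0] is [0], and both sides vanish. *)
have [->|t0] := eqVneq t 0.
  by apply: eq_bigr => d _; rewrite /= /dilation invr0 mulr0 !mul0r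
    !linear0 !mulr0 !mul0r.
transitivity (T ((f \o dilation t^-1) \o dilation s) g).
  by apply: eq_bigr => d _; rewrite /= /dilation !mulrA ![t^-1 * _]mulrC.
rewrite sP.
(* With [s] written as [(s / t) * t], the factor [t] can move back and cancel [t^-1]. *)
transitivity (T (f \o dilation t^-1) ((g \o dilation (s / t)) \o dilation t)).
  by apply: eq_bigr => d _; rewrite /= /dilation !mulrA !divfK.
rewrite -tP.
by apply: eq_bigr => d _; rewrite /= /dilation !mulKf.
Qed.

Lemma slope_field g :
    (forall n (b : 'I_n -> R), (forall i, b i \in slope_pred) -> rat_free b ->
      (n <= g)%N) ->
  exists (K : fieldExtType rat) (iota : {rmorphism K -> R}),
    (forall s, isotropic (fun d => Y d - s * X d) <-> exists z, s = iota z) /\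
    (\dim {:K} <= g)%N.
Proof.
move=> /(bounded_subfield slope_pred_divring)[K [iota [iotaP dimK]]].
exists K, iota; split=> // s.
by rewrite -iotaP; split=> [/asboolP|sS]; last exact/asboolP.
Qed.

(** In finite ℚ-coordinates of the values of [X] and [Y], the real pairing is the combination of the
    rationals [T (f k) (f l)] with coefficients [e k * e l]. *)
Lemma period_pairing_neq0 : period_pairing phi X Y != 0 ->
  exists f g : rat_form R, T f g != 0.
Proof.
move=> XY0; apply: contrapT => T0; move/eqP: XY0; apply.
have {}T0 (f g : rat_form R) : T f g = 0.
  by apply/eqP; apply: contrapT => /negP fg; apply: T0; exists f, g.
have [n [e [f ef]]] := @finite_coordinates rat (rat_space R^o) (codom X ++ codom Y).
have XE d : X d = \sum_k ratr (f k (X d)) * e k by apply: ef; rewrite mem_cat codom_f.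
have YE d : Y d = \sum_k ratr (f k (Y d)) * e k.
  by apply: ef; rewrite mem_cat codom_f orbT.
transitivity (\sum_k \sum_l ratr (T (f k) (f l)) * (e k * e l : R)); last first.
  by rewrite big1 // => k _; rewrite big1 // => l _; rewrite T0 rmorph0 mul0r.
have prodE (u v : R) : u = \sum_k ratr (f k u) * e k -> v = \sum_k ratr (f k v) * e k ->
    u * v = \sum_k \sum_l ratr (f k u * f l v) * (e k * e l : R).
  move=> uE vE; rewrite {1}uE mulr_suml; apply: eq_bigr => k _.
  rewrite {1}vE mulr_sumr; apply: eq_bigr => l _.
  by rewrite rmorphM mulrACA.
rewrite /period_pairing.
under eq_bigr => d _ do rewrite (prodE _ _ (XE d) (YE _))
  (prodE _ _ (XE _) (YE d)) -sumrB.
rewrite exchange_big; apply: eq_bigr => k _.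
under eq_bigr do rewrite -sumrB; rewrite exchange_big; apply: eq_bigr => l _.
rewrite rmorph_sum mulr_suml; apply: eq_bigr => d _.
by rewrite rmorphB mulrBl.
Qed.

Hypotheses (phi_inj : injective phi) (alphaK : involutive alpha).
Hypothesis alpha_fixfree : forall d, alpha d != d.
Hypothesis connected : forall h : D -> rat,
  h \o phi =1 h -> h \o alpha =1 h -> forall d d', h d = h d'.
Hypotheses (X_closed : closed_form phi alpha X) (Y_closed : closed_form phi alpha Y).

(** The numbers [b j * w g0] are free over ℚ; forms [f i] dual to them give an isotropic family
    [f i \o X], dual to the closed family [g0 \o dilation (b j) \o Y]. *)
Lemma slope_free_bound n (b : 'I_n -> R) : period_pairing phi X Y != 0 ->
    (forall i, b i \in slope_pred) -> rat_free b ->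
  (fcard phi D + fcard (phi \o alpha) D + n.*2 <= #|D|./2 + 2)%N.
Proof.
move=> /period_pairing_neq0[f0 [g0 T0]] bS b_free.
(* Contracting the second slot of the pairing with a form [g] gives a real
   [w g] with [s * w g = w (g \o dilation s)] for every slope [s]. *)
pose w (g : R -> rat) : R := period_pairing phi X (fun d => ratr (g (Y d))).
have wE (f g : rat_form R) : f (w g) = T f g.
  rewrite linear_sum; apply: eq_bigr => d _.
  by rewrite linearB !rat_form_mulr mulrC [in X in _ - X = _]mulrC.
have w0 : w g0 != 0.
  by apply: contraNneq T0 => w0; rewrite -wE w0 linear0.
have [f fE] : exists f : 'I_n -> rat_form R, forall i j, f i (b j * w g0) = (i == j)%:R.
  apply: dual_forms => c c0; apply: b_free; apply: (mulIf w0).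
  by rewrite mul0r mulr_suml -[RHS]c0; apply: eq_bigr => j _; rewrite mulrA.
have form_closed (h : rat_form R) u : closed_form phi alpha u ->
    closed_form phi alpha (h \o u).
  by move=> u_closed d /=; rewrite -!raddfB u_closed raddfN.
apply: (isotropic_bound phi_inj alphaK alpha_fixfree connected
  (c := fun i => f i \o X) (y := fun j => (g0 \o dilation (b j)) \o Y)).
- by move=> i; apply: form_closed.
- by move=> j; apply: (form_closed (g0 \o dilation (b j))).
- by move=> i j; apply: X_iso.
- by move=> i j; have /slope_predP <- := bS j; rewrite -wE; apply: fE.
Qed.

End PeriodicSlopes.

(** * Translation surfaces *)

Section PlaneCoordinates.
Variable R : realType.
Implicit Types (u v w : plane R) (A : 'M[R]_2).

Lemma ord2P (j : 'I_2) : j = 0 \/ j = 1.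
Proof. by case: j => -[|[|//]] lt; [left|right]; apply: val_inj. Qed.

Lemma xcoord_mulmx u A : xcoord (u *m A) = xcoord u * A 0 0 + ycoord u * A 1 0.
Proof.
rewrite /xcoord /ycoord mxE !big_ord_recl big_ord0 addr0.
by have -> : lift ord0 ord0 = 1 :> 'I_2 by apply: val_inj.
Qed.

Lemma ycoord_mulmx u A : ycoord (u *m A) = xcoord u * A 0 1 + ycoord u * A 1 1.
Proof.
rewrite /xcoord /ycoord mxE !big_ord_recl big_ord0 addr0.
by have -> : lift ord0 ord0 = 1 :> 'I_2 by apply: val_inj.
Qed.

Lemma det_mx2 A : \det A = A 0 0 * A 1 1 - A 0 1 * A 1 0.
Proof.
rewrite (expand_det_row A 0) !big_ord_recl big_ord0 addr0 /cofactor !det_mx11 !mxE /=.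
have -> : lift ord0 ord0 = 1 :> 'I_2 by apply: val_inj.
have -> : lift 1 0 = 0 :> 'I_2 by apply: val_inj.
by rewrite /bump /=; ring.
Qed.

Lemma cross_mulmx u v A : cross (u *m A) (v *m A) = \det A * cross u v.
Proof. by rewrite /cross !xcoord_mulmx !ycoord_mulmx det_mx2; ring. Qed.

Lemma plane_eq u v : xcoord u = xcoord v -> ycoord u = ycoord v -> u = v.
Proof. by move=> xe ye; apply/rowP => j; case: (ord2P j) => ->. Qed.

Lemma xcoordZ a u : xcoord (a *: u) = a * xcoord u.
Proof. by rewrite /xcoord mxE. Qed.

Lemma ycoordZ a u : ycoord (a *: u) = a * ycoord u.
Proof. by rewrite /ycoord mxE. Qed.

Lemma xcoordB u v : xcoord (u - v) = xcoord u - xcoord v.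
Proof. by rewrite /xcoord !mxE. Qed.

Lemma ycoordB u v : ycoord (u - v) = ycoord u - ycoord v.
Proof. by rewrite /ycoord !mxE. Qed.

Lemma xcoord_pt (a b : R) : xcoord (pt a b) = a.
Proof. by rewrite /xcoord mxE. Qed.

Lemma ycoord_pt (a b : R) : ycoord (pt a b) = b.
Proof. by rewrite /ycoord mxE. Qed.

Lemma xcoord_slope (s : option R) : xcoord (slope_vec s) = (if s is Some _ then 1 else 0).
Proof. by case: s => [a|]; apply: xcoord_pt. Qed.

Lemma ycoord_slope (s : option R) : ycoord (slope_vec s) = (if s is Some a then a else 1).
Proof. by case: s => [a|]; apply: ycoord_pt. Qed.

Lemma cross_slope_neq0 (s t : option R) : s != t ->
  cross (slope_vec s) (slope_vec t) != 0.
Proof.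
rewrite /cross !xcoord_slope !ycoord_slope; case: s t => [a|] [b|] //= ab.
- by rewrite mul1r mulr1 subr_eq0; apply: contra ab => /eqP->.
- by rewrite mul1r mulr0 subr0 oner_eq0.
- by rewrite mul0r mul1r sub0r oppr_eq0 oner_eq0.
Qed.

Lemma slope_vec_neq0 (s : option R) : slope_vec s != 0.
Proof.
case: s => [a|].
  by apply/eqP => /(congr1 (@xcoord R)); rewrite xcoord_slope /xcoord mxE => /eqP;
    rewrite oner_eq0.
by apply/eqP => /(congr1 (@ycoord R)); rewrite ycoord_slope /ycoord mxE => /eqP;
  rewrite oner_eq0.
Qed.

Definition slope v : option R :=
  if xcoord v == 0 then None else Some (ycoord v / xcoord v).

Lemma slopeP v : v != 0 -> exists2 c, c != 0 & v = c *: slope_vec (slope v).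
Proof.
move=> v0; rewrite /slope; have [x0|x0] := eqVneq (xcoord v) 0.
  exists (ycoord v).
    apply: contra v0 => /eqP y0; apply/eqP; apply: plane_eq.
      by rewrite x0 /xcoord mxE.
    by rewrite y0 /ycoord mxE.
  by apply: plane_eq;
    rewrite (xcoordZ, ycoordZ) (xcoord_slope, ycoord_slope) (mulr0, mulr1).
by exists (xcoord v) => //; apply: plane_eq;
  rewrite (xcoordZ, ycoordZ) (xcoord_slope, ycoord_slope) ?mulr1 // mulrCA divff ?mulr1.
Qed.

Lemma cross_parallel a b v : cross (a *: v) (b *: v) = 0.
Proof. by rewrite /cross !(xcoordZ, ycoordZ); ring. Qed.

End PlaneCoordinates.

(** Turns the term of a triangle into a sum over its oriented edges, where opposite edges can
    cancel. *)
Lemma wedge_triangle (K : numFieldType) (V : lmodType K) (a b c : V) :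
  wedge (b - a) (c - b) = wedge a b + (wedge b c + wedge c a).
Proof.
have wedgeBl u v w : wedge (u - v) w = wedge u w - wedge v w :> extsq V.
  by rewrite wedgeC linearB opprB /= [wedge v w]wedgeC opprK [wedge u w]wedgeC addrC.
rewrite linearB /= !wedgeBl wedgevv sub0r opprK [wedge c a]wedgeC.
by rewrite [RHS]addrC.
Qed.

(** * The gluing as a pair of dart maps, and the invariant as a sum over sides *)

Section Surface.
Variables (R : realType) (S : translation_surface R).

Local Notation D := (side_of (@piece R S)).
Local Notation phi := (@side_next R _ (@piece R S)).
Local Notation alpha := (@glue R S).

Definition side_start (e : D) : plane R := vertex (tagged e).

Lemma side_vecE (e : D) : side_vec e = side_start (phi e) - side_start e.
Proof. by []. Qed.

Lemma side_next_inj : injective phi.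
Proof.
pose prev (e : D) : D := Tagged (fun i => 'I_(nsides (piece i))) (ord_pred (tagged e)).
by apply: (@can_inj _ _ _ prev) => -[i k]; rewrite /prev /side_next /= ordSK.
Qed.

(** A zero side would make two successive vertices coincide, against simplicity of the boundary. *)
Lemma side_vec_neq0 (e : D) : side_vec e != 0.
Proof.
case: e => i k; rewrite /side_vec /= subr_eq0; apply/eqP => kk.
have [|||/esym] := @polygon_simple R (piece i) (ordS k) k 0 0.
- by rewrite lexx ltr01.
- by rewrite lexx ltr01.
- by rewrite !subr0 !scale1r !scale0r !addr0.
have key m n : (m = m.+1 %% n -> 2 < n -> m < n -> False)%N.
  move=> mE n2 mn; have [lt|eq] : (m.+1 < n \/ m.+1 = n)%N by lia.
    by move: mE; rewrite modn_small //; lia.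
  by move: mE; rewrite eq modnn; lia.
move=> /(congr1 val) kE _.
exact: (key _ _ kE (polygon_nsides (piece i)) (ltn_ord k)).
Qed.

(** A side glued to itself would equal its own negative as a vector. *)
Lemma glue_fixfree (e : D) : alpha e != e.
Proof.
apply: contraNneq (side_vec_neq0 e) => ge.
have := glue_translation e; rewrite ge => /eqP.
by rewrite -addr_eq0 -mulr2n -scaler_nat scaler_eq0 pnatr_eq0.
Qed.

(** [phi] runs through all sides of one polygon, and [alpha] passes between the polygons of a
    connecting path. *)
Lemma sides_connected (T : Type) (h : D -> T) :
  h \o phi =1 h -> h \o alpha =1 h -> forall d d', h d = h d'.
Proof.
move=> hphi halpha.
have polygonE i (k l : 'I_(nsides (piece i))) :
    h (Tagged (fun i => 'I_(nsides (piece i))) k) =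
    h (Tagged (fun i => 'I_(nsides (piece i))) l).
  have n0 : (0 < nsides (piece i))%N by apply: leq_trans (polygon_nsides _).
  suff H m (lt : (m < nsides (piece i))%N) :
      h (Tagged (fun i => 'I_(nsides (piece i))) (Ordinal lt)) =
      h (Tagged (fun i => 'I_(nsides (piece i))) (Ordinal n0)).
    by case: k l => [k kn] [l ln]; rewrite !H.
  elim: m lt => [|m IH] lt; first by congr (h (Tagged _ _)); apply: val_inj.
  rewrite -(IH (ltnW lt)) -[RHS]hphi; congr (h (Tagged _ _)); apply: val_inj => /=.
  by rewrite modn_small.
have tagE d d' : tag d = tag d' -> h d = h d'.
  by case: d d' => [i k] [j l] /= ij; case: _ / ij l => l; apply: polygonE.
move=> d d'; have /connectP[p pP dp] := surface_connected (tag d) (tag d').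
elim: p d pP dp => [|j p IH] d /=; first by move=> _ /esym/tagE.
case/andP=> /existsP[e /andP[/eqP ed /eqP ej]] pP dp.
rewrite (tagE d e) // -halpha; apply: IH; rewrite ?ej //.
Qed.

(** [phi] preserves the polygon, so mapping orbit roots to polygons is onto. *)
Lemma npolygons_le_fcard : (npolygons S <= fcard phi {: D})%N.
Proof.
rewrite -[X in (X <= _)%N]card_ord /n_comp_mem.
apply: leq_trans (leq_imset_card (fun e : D => tag e) _).
apply/subset_leq_card/fintype.subsetP => i _.
have n0 : (0 < nsides (piece i))%N by apply: leq_trans (polygon_nsides _).
pose e : D := Tagged (fun i => 'I_(nsides (piece i))) (Ordinal n0).
apply/imsetP; exists (froot phi e).
  by rewrite inE /= (roots_root (fconnect_sym side_next_inj)).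
apply: (fconnect_invariant (k := fun d : D => tag d) _ (connect_root _ e)) => d.
by rewrite /= eqxx.
Qed.

(** Euler's formula, with the number of faces of [S] at most the number of [phi]-orbits. *)
Lemma leq_genus n :
  (fcard phi {: D} + fcard (phi \o alpha) {: D} + n.*2 <= #|{: D}|./2 + 2)%N ->
  (n <= genus S)%N.
Proof.
have arith f v e p : (p <= f -> f + v + n.*2 <= e + 2 -> n <= (2 + e - (v + p))./2)%N.
  by rewrite geq_half_double; lia.
exact: arith npolygons_le_fcard.
Qed.

Local Notation wedgeP := (@wedge rat (rat_space (plane R))).

Lemma triangle_wedge (T : triangle R) :
  wedgeP (triangle_v T) (triangle_w T) = \sum_(e <- triangle_sides T) wedgeP e.1 e.2.
Proof.
case: T => [[a b] c]; rewrite /triangle_v /triangle_w /=.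
rewrite !big_cons big_nil [X in _ + (_ + X)]addr0.
exact: (@wedge_triangle rat (rat_space (plane R))).
Qed.

Lemma triangulates_wedge (P : polygon R) t : triangulates P t ->
  \sum_(T <- t) wedgeP (triangle_v T) (triangle_w T) =
  \sum_k wedgeP (@vertex _ P k) (vertex (ordS k)).
Proof.
case=> _ [d perm_d]; pose F (e : plane R * plane R) := wedgeP e.1 e.2.
have FC e : F (e.2, e.1) = - F e by apply: wedgeC.
rewrite (eq_bigr (fun T => \sum_(e <- triangle_sides T) F e)); last first.
  by move=> T _; apply: triangle_wedge.
rewrite -(big_map (@triangle_sides R) xpredT (fun s => \sum_(e <- s) F e)).
rewrite -big_flatten (perm_big _ perm_d) /= big_cat big_cat /= [X in _ + (_ + X)]big_map.
rewrite -[X in _ + X]big_split [X in _ + X]big1 => [|e _]; last first.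
  by rewrite FC; apply: addrN.
by rewrite -[RHS]addr0 /sides big_map big_enum.
Qed.

(** The right-hand side does not mention [t]: this is independence of the triangulation. *)
Lemma J_invariantE (t : 'I_(npolygons S) -> seq (triangle R)) : triangulation t ->
  J_invariant t = \sum_(e : D) wedgeP (side_start e) (side_start (phi e)).
Proof.
move=> tr; rewrite /J_invariant; under eq_bigr do rewrite (triangulates_wedge (tr _)).
by rewrite (@sig_big_dep _ _ _ _ (fun i => 'I_(nsides (piece i))) xpredT (fun _ => xpredT)
  (fun i k => wedgeP (vertex k) (vertex (ordS k)))).
Qed.

(** The factor [1 / |v|] of [perp_proj] is a nonzero real, removed by [isotropic_scale]. *)
Lemma alg_periodicE (v : plane R) : alg_periodic S v <->
  [/\ v != 0, exists t : 'I_(npolygons S) -> seq (triangle R), triangulation t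
   & isotropic phi (fun e : D => cross v (side_start e))].
Proof.
have SAF_isotropic (t : 'I_(npolygons S) -> seq (triangle R)) :
    v != 0 -> triangulation t -> SAF v (J_invariant t) = 0 <->
    isotropic phi (fun e : D => cross v (side_start e)).
  move=> v0 tr; rewrite J_invariantE // /SAF linear_sum.
  under eq_bigr do rewrite /= extsq_map_wedge /=.
  have c0 : (Num.sqrt (xcoord v ^+ 2 + ycoord v ^+ 2))^-1 != 0.
    rewrite invr_eq0 sqrtr_eq0 -ltNge lt0r addr_ge0 ?sqr_ge0 // andbT.
    rewrite paddr_eq0 ?sqr_ge0 // !sqrf_eq0; apply: contra v0 => /andP[/eqP vx /eqP vy].
    apply/eqP; apply: plane_eq; first by rewrite vx /xcoord mxE.
    by rewrite vy /ycoord mxE.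
  rewrite (isotropic_scale _ _ c0).
  split=> [/sum_wedge_eq0 iso f g|iso].
    rewrite -[RHS](iso f g); apply: eq_bigr => e _.
    by rewrite /= /perp_proj ![_^-1 * _]mulrC.
  apply/sum_wedge_eq0 => f g; rewrite -[RHS](iso f g); apply: eq_bigr => e _.
  by rewrite /= /perp_proj ![_^-1 * _]mulrC.
split=> [[v0 [t [tr s0]]]|[v0 [t tr] iso]].
  by split=> //; [exists t|apply/(SAF_isotropic t v0 tr)].
by split=> //; exists t; split=> //; apply/(SAF_isotropic t v0 tr).
Qed.

End Surface.

(** * Periodic directions in linear coordinates *)

Section AlgebraicallyPeriodicDirections.
Variables (R : realType) (S : translation_surface R).

Local Notation D := (side_of (@piece R S)).
Local Notation phi := (@side_next R _ (@piece R S)).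

Lemma alg_periodicZ c (v : plane R) : c != 0 ->
  alg_periodic S v <-> alg_periodic S (c *: v).
Proof.
move=> c0; rewrite !alg_periodicE scaler_eq0 negb_or c0 /=.
have E : (fun e : D => cross (c *: v) (side_start e)) =
    (fun e : D => c * cross v (side_start e)).
  by apply/funext => e; rewrite /cross xcoordZ ycoordZ; ring.
have iso_scale := isotropic_scale phi (fun e : D => cross v (side_start e)) c0.
by rewrite E; split=> -[v0 tr iso]; split=> //; apply/iso_scale.
Qed.

Variable A : 'M[R]_2.
Hypothesis A_unit : A \in unitmx.

Let coords (e : D) : plane R := side_start e *m invmx A.
Let X (e : D) := xcoord (coords e).
Let Y (e : D) := ycoord (coords e).

(** [cross] changes by [\det A] under [A], and in the new coordinates its value against
    [slope_vec s] is [Y - a * X], or [- X] for the infinite slope. *)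
Lemma alg_periodic_slope s : alg_periodic S (slope_vec s *m A) <->
  (exists t : 'I_(npolygons S) -> seq (triangle R), triangulation t) /\
  isotropic phi (if s is Some a then fun e => Y e - a * X e else X).
Proof.
have detA0 : \det A != 0 by rewrite -unitfE -unitmxE.
rewrite alg_periodicE.
have sA0 : slope_vec s *m A != 0.
  apply: contraTneq isT => sA0; have := slope_vec_neq0 s.
  by rewrite -[slope_vec s](mulmxK A_unit) sA0 mul0mx eqxx.
have E : (fun e : D => cross (slope_vec s *m A) (side_start e)) =
    (fun e => (if s is Some _ then \det A else - \det A) *
              (if s is Some a then fun e => Y e - a * X e else X) e).
  apply/funext => e; rewrite -[side_start e](mulmxKV A_unit) cross_mulmx.
  by rewrite /cross xcoord_slope ycoord_slope /X /Y /coords; case: s {sA0} => [a|]; ring.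
have d0 : (if s is Some _ then \det A else - \det A) != 0.
  by case: (s); rewrite ?oppr_eq0.
have iso_scale := isotropic_scale phi
  (if s is Some a then fun e => Y e - a * X e else X) d0.
by rewrite E; split=> [[_ tr /iso_scale iso]|[tr iso]]; split=> //; apply/iso_scale.
Qed.

(** By the shoelace formula the pairing is [\det (invmx A)] times twice the total area. *)
Lemma period_area : period_pairing phi X Y != 0.
Proof.
have dA0 : \det (invmx A) != 0 by rewrite -unitfE -unitmxE unitmx_inv.
have -> : period_pairing phi X Y =
    \det (invmx A) * \sum_(e : D) cross (side_start e) (side_start (phi e)).
  rewrite mulr_sumr; apply: eq_bigr => e _.
  by rewrite -cross_mulmx /cross /X /Y /coords; ring.
rewrite mulf_neq0 // gt_eqF //.
have -> : \sum_(e : D) cross (side_start e) (side_start (phi e)) =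
    \sum_i \sum_k cross (vertex k) (vertex (ordS k : 'I_(nsides (@piece R S i)))).
  by rewrite (@sig_big_dep _ _ _ _ (fun i => 'I_(nsides (@piece R S i))) xpredT
    (fun _ => xpredT) (fun i k => cross (vertex k) (vertex (ordS k)))).
rewrite (bigD1 (Ordinal (npolygons_gt0 S))) //= ltr_pwDl ?polygon_ccw //.
by apply: sumr_ge0 => i _; apply/ltW/polygon_ccw.
Qed.

Lemma coord_closed (u : plane R -> R) : {morph u : v w / v - w} ->
  closed_form phi (@glue R S) (fun e => u (coords e)).
Proof.
move=> uB e; rewrite /coords -!uB -!mulmxBl -!side_vecE glue_translation mulNmx.
by rewrite -[- (_ *m _)]sub0r uB -(subrr (0 : plane R)) uB subrr sub0r.
Qed.

(** The slopes [∞], [0] and [1] make [X], [Y] and [Y - X] isotropic, and the nonzero area feeds the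
    degree bound. *)
Theorem alg_periodic_field :
    alg_periodic S (slope_vec (Some 0) *m A) ->
    alg_periodic S (slope_vec (Some 1) *m A) ->
    alg_periodic S (slope_vec None *m A) ->
  exists (K : fieldExtType rat) (iota : {rmorphism K -> R}),
    (forall s : option R, alg_periodic S (slope_vec s *m A) <->
       (if s is Some a then exists x : K, a = iota x else True)) /\
    (\dim {:K} <= genus S)%N.
Proof.
move=> per0 per1 peroo.
have [triang X_iso] := (alg_periodic_slope None).1 peroo.
have Y_iso : isotropic phi Y.
  have [_] := (alg_periodic_slope (Some 0)).1 per0.
  by congr isotropic; apply/funext => e; rewrite mul0r subr0.
have YX_iso : isotropic phi (fun e => Y e - X e).
  have [_] := (alg_periodic_slope (Some 1)).1 per1.
  by congr isotropic; apply/funext => e; rewrite mul1r.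
have [|K [iota [iotaP dimK]]] := @slope_field R _ phi X Y X_iso Y_iso YX_iso (genus S).
  move=> n b bS b_free; apply: leq_genus.
  apply: (slope_free_bound X_iso Y_iso YX_iso _ _ _ _ _ _ period_area bS b_free).
  - exact: side_next_inj.
  - exact: glueK.
  - exact: glue_fixfree.
  - exact: sides_connected.
  - exact/coord_closed/xcoordB.
  - exact/coord_closed/ycoordB.
exists K, iota; split=> [s|]; last exact: dimK.
apply: iff_trans (alg_periodic_slope s) _.
case: s => [a|]; last by split=> [_|_]; [|split].
by split=> [[_ /iotaP]|/iotaP iso]; [|split].
Qed.

End AlgebraicallyPeriodicDirections.

(** * From three periodic directions to infinitely many *)

Section ThreeDirections.
Variables (R : realType) (S : translation_surface R).

Lemma three_slopes_basis (s1 s2 s3 : option R) : uniq [:: s1; s2; s3] ->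
  exists2 A : 'M[R]_2, A \in unitmx & exists c1 c2 c3 : R,
    [/\ c1 != 0, c2 != 0 & c3 != 0] /\
    [/\ slope_vec (Some 0) *m A = c1 *: slope_vec s1,
        slope_vec (Some 1) *m A = c2 *: slope_vec s2 &
        slope_vec None *m A = c3 *: slope_vec s3].
Proof.
rewrite /= !inE negb_or => /and3P[/andP[s12 s13] s23 _].
have c12 := cross_slope_neq0 s12; have c13 := cross_slope_neq0 s13.
have c23 := cross_slope_neq0 s23.
move: (slope_vec s1) (slope_vec s2) (slope_vec s3) c12 c13 c23 => u1 u2 u3 c12 c13 c23.
(* The rows are scaled so that they sum to [cross u1 u3 *: u2], by the linear relation between three
   plane vectors. *)
pose A : 'M[R]_2 := \matrix_(i, j)
  (if i == 0 then cross u2 u3 * u1 0 j else cross u1 u2 * u3 0 j).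
exists A.
  rewrite unitmxE unitfE det_mx2 !mxE /=.
  have -> : cross u2 u3 * u1 0 0 * (cross u1 u2 * u3 0 1) -
      cross u2 u3 * u1 0 1 * (cross u1 u2 * u3 0 0) =
      cross u2 u3 * cross u1 u2 * cross u1 u3.
    by rewrite /cross /xcoord /ycoord; ring.
  by rewrite !mulf_neq0.
exists (cross u2 u3), (cross u1 u3), (cross u1 u2); split=> //.
split; apply: plane_eq; rewrite !(xcoord_mulmx, ycoord_mulmx, xcoordZ, ycoordZ);
  by rewrite !(xcoord_pt, ycoord_pt) !mxE /cross /xcoord /ycoord /=; ring.
Qed.

(** In coordinates where the three slopes are [0], [1] and [∞], the field contains all natural
    numbers. *)
Theorem three_directions_infinite (s1 s2 s3 : option R) :
    uniq [:: s1; s2; s3] -> alg_periodic S (slope_vec s1) ->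
    alg_periodic S (slope_vec s2) -> alg_periodic S (slope_vec s3) ->
  infinite_set [set s : option R | alg_periodic S (slope_vec s)].
Proof.
move=> us p1 p2 p3.
have [A Au [c1 [c2 [c3 [[c10 c20 c30] [e1 e2 e3]]]]]] := three_slopes_basis us.
have [|||K [iota [perE _]]] := @alg_periodic_field R S A Au.
- by rewrite e1; exact: (alg_periodicZ S _ c10).1 p1.
- by rewrite e2; exact: (alg_periodicZ S _ c20).1 p2.
- by rewrite e3; exact: (alg_periodicZ S _ c30).1 p3.
pose v (n : nat) : plane R := slope_vec (Some n%:R) *m A.
have per n : alg_periodic S (v n).
  apply: (perE (Some n%:R)).2; by exists n%:R; rewrite rmorph_nat.
have v0 n : v n != 0 by case: (per n).
(* The vectors [v m] and [v n] have cross product [\det A * (n - m)], so they are parallel only if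
   [m = n]. *)
have slope_inj : injective (fun n => slope (v n)).
  move=> m n /= smn; have [a _ ma] := slopeP (v0 m); have [b _ nb] := slopeP (v0 n).
  have : cross (v m) (v n) = 0 by rewrite ma nb smn cross_parallel.
  move/eqP; rewrite cross_mulmx mulf_eq0 -[_ == 0]negbK -unitfE -unitmxE Au /=.
  rewrite /cross !(xcoord_pt, ycoord_pt) mul1r mulr1 subr_eq0 eqr_nat.
  by move/eqP.
move=> fin; apply: infinite_nat.
have := finite_preimage (in2W slope_inj) fin; apply: sub_finite_set => n _ /=.
have [c c0 vc] := slopeP (v0 n); apply: (alg_periodicZ S _ c0).2.
by rewrite -vc; exact: per.
Qed.

End ThreeDirections.

Theorem theorem1p1 (R : realType) (S : translation_surface R) :
  ((exists s1 s2 s3 : option R,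
      [/\ uniq [:: s1; s2; s3],
          alg_periodic S (slope_vec s1),
          alg_periodic S (slope_vec s2) &
          alg_periodic S (slope_vec s3)]) ->
   infinite_set [set s : option R | alg_periodic S (slope_vec s)]) /\
  (* coordinates (x, y) on the plane: the vector (x, y) *m A *)
  (forall A : 'M[R]_2, A \in unitmx ->
     alg_periodic S (slope_vec (Some 0) *m A) ->
     alg_periodic S (slope_vec (Some 1) *m A) ->
     alg_periodic S (slope_vec None *m A) ->
     exists (K : fieldExtType rat) (iota : {rmorphism K -> R}),
       (forall s : option R,
          alg_periodic S (slope_vec s *m A) <->
          (if s is Some a then exists x : K, a = iota x else True)) /\
       (\dim {:K} <= genus S)%N).
Proof.
split=> [[s1 [s2 [s3 [us p1 p2 p3]]]]|A Au p0 p1 poo].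
  exact: three_directions_infinite us p1 p2 p3.
exact: alg_periodic_field Au p0 p1 poo.
Qed.
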